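(* Let $V,V_1,\ldots, V_n$ be valuations for a field $K$ and $x\in K$. If $V[x]\nsubseteq \bigcup_{i=1}^n V_i$, then there exists $v\in V$ such that $v+x\notin \bigcup_{i=1}^n V_i$.
   Context: A ''valuation for a field $K$'' means a valuation ring of $K$, i.e. a subring $V$ of $K$ such that for every nonzero $y\in K$, $y\in V$ or $y^{-1}\in V$. $V[x]$ denotes the subring of $K$ generated by $V$ and $x$. *)

(* Defs.v *)
From HB Require Import structures.
From mathcomp Require Import all_boot all_order all_algebra.
From mathcomp Require Import boolp classical_sets.

Set Implicit Arguments.
Unset Strict Implicit.
Unset Printing Implicit Defensive.

Import GRing.Theory.
Local Open Scope classical_set_scope.
Local Open Scope ring_scope.

Definition is_subring (K : fieldType) (V : set K) : Prop :=
  subring_closed [in V].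

Definition is_valuation_ring (K : fieldType) (V : set K) : Prop :=
  is_subring V /\ forall y : K, y != 0 -> V y \/ V y^-1.

Definition adjoin (K : fieldType) (V : set K) (x : K) : set K :=
  smallest (@is_subring K) (V `|` [set x]).

(* Main.v *)
Require Import Defs.
From HB Require Import structures.
From mathcomp Require Import all_boot all_order all_algebra.
From mathcomp Require Import boolp classical_sets.

(** The complement of a valuation ring [W] is closed under multiplication and
    under translation by elements of [W].  Hence, if [a] is outside [W], the
    elements [a ^+ k + x] with [k > 0] meet [W] at most once, whatever [x] is:
    the difference [a ^+ k * (a ^+ d - 1)] of two of them is a product of
    elements outside [W].  So [a ^+ k + x] leaves [W] for all large [k], and it
    leaves finitely many valuation rings at once if [a] is outside all of them
    ([exprD_notin_seq]).

    This gives an avoidance principle ([subring_avoid]): a subring contained in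
    none of finitely many valuation rings has an element outside all of them.

    For the theorem, no [V_ i] contains both [V] and [x], as it would then
    contain [V[x]].  By avoidance, some [a] in [V] lies outside every [V_ i]
    that does not contain [V].  For large [k], the element [a ^+ k + x] is
    outside these [V_ i]; each other [V_ i] contains [V] but not [x], so
    [a ^+ k + x] is outside it for every [k]. *)

Set Implicit Arguments.
Unset Strict Implicit.
Unset Printing Implicit Defensive.

Import GRing.Theory.
Local Open Scope classical_set_scope.
Local Open Scope ring_scope.

Section Subring.
Variables (K : fieldType) (W : set K).
Hypothesis ringW : is_subring W.

Lemma subring1 : W 1.
Proof. by case: ringW => /set_mem. Qed.

Lemma subringB a b : W a -> W b -> W (a - b).
Proof.
by case: ringW => _ clB _ Wa Wb; apply/set_mem/clB; apply/mem_set.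
Qed.

Lemma subringM a b : W a -> W b -> W (a * b).
Proof.
by case: ringW => _ _ clM Wa Wb; apply/set_mem/clM; apply/mem_set.
Qed.

Lemma subringX a k : W a -> W (a ^+ k).
Proof.
move=> Wa; elim: k => [|k IHk]; first by rewrite expr0; exact: subring1.
by rewrite exprS; exact: subringM.
Qed.

Lemma subringN a : W a -> W (- a).
Proof.
by move=> Wa; rewrite -sub0r -(subrr a); do !apply: subringB.
Qed.

Lemma subringD a b : W a -> W b -> W (a + b).
Proof.
by move=> Wa Wb; rewrite -[b]opprK; apply: subringB => //; exact: subringN.
Qed.

Lemma subring_addl_notin a b : W a -> ~ W b -> ~ W (a + b).
Proof.
by move=> Wa Wb Wab; apply: Wb; rewrite -(addKr a b) addrC; exact: subringB.
Qed.

End Subring.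

Section Valuation.
Variables (K : fieldType) (W : set K).
Hypothesis valW : is_valuation_ring W.

Let ringW : is_subring W := valW.1.

(** An element [b] outside [W] has its inverse in [W], so [a * b] in [W] would
    put [a = a * b / b] in [W]. *)
Lemma valuation_mul_notin a b : ~ W a -> ~ W b -> ~ W (a * b).
Proof.
move=> Wa Wb Wab; have b0 : b != 0.
  apply/eqP => b0; apply: Wb; rewrite b0 -(subrr 1).
  by apply: subringB => //; exact: subring1.
have [//|Wb'] := valW.2 b b0.
by apply: Wa; rewrite -(mulfK b0 a); exact: subringM.
Qed.

Lemma valuation_expr_notin a k : ~ W a -> ~ W (a ^+ k.+1).
Proof.
move=> Wa; elim: k => [|k IHk]; first by rewrite expr1.
by rewrite exprS; exact: valuation_mul_notin.
Qed.

Lemma valuation_exprD_notin a x : ~ W a ->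
  exists N, forall k, (N <= k)%N -> ~ W (a ^+ k + x).
Proof.
move=> Wa; have [[m Wm]|noW] := pselect (exists m, W (a ^+ m.+1 + x)); last first.
  by exists 1%N => -[//|k] _ Wk; apply: noW; exists k.
(* The single exceptional exponent is [m.+1]. *)
exists m.+2 => k mk Wk.
have : W (a ^+ m.+1 * (a ^+ (k - m.+2).+1 - 1)).
  rewrite mulrBr mulr1 -exprD (_ : (m.+1 + (k - m.+2).+1)%N = k).
    by rewrite -(addrKA x) [x + _]addrC; exact: subringB.
  by rewrite addnS -addSn subnKC.
apply: valuation_mul_notin; first exact: valuation_expr_notin.
rewrite addrC; apply: subring_addl_notin => //; last exact: valuation_expr_notin.
by apply: subringN => //; exact: subring1.
Qed.

End Valuation.

Section Avoidance.
Variables (K : fieldType) (I : eqType) (W : I -> set K).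
Hypothesis valW : forall i, is_valuation_ring (W i).

Lemma exprD_notin_seq (s : seq I) a x : (forall i, i \in s -> ~ W i a) ->
  exists N, forall k, (N <= k)%N -> forall i, i \in s -> ~ W i (a ^+ k + x).
Proof.
elim: s => [|j s IHs] Wa; first by exists 0%N.
have [i si|N1 N1P] := IHs; first by apply: Wa; rewrite inE si orbT.
have [|N2 N2P] := valuation_exprD_notin (valW j) (a := a) x.
  by apply: Wa; rewrite mem_head.
exists (maxn N1 N2) => k; rewrite geq_max => /andP[N1k N2k] i.
by rewrite inE => /predU1P[->|]; [exact: N2P|exact: N1P].
Qed.

(** Suppose [a] avoids all rings but [W j], and [b] avoids [W j].  If [a] is in
    [W j], then [a ^+ k + b] still avoids [W j], for every [k], and avoids the
    other rings once [k] is large. *)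
Lemma subring_avoid (V : set K) (s : seq I) : is_subring V ->
    (forall i, i \in s -> ~ V `<=` W i) ->
  exists2 a, V a & forall i, i \in s -> ~ W i a.
Proof.
move=> ringV; elim: s => [|j s IHs] VW.
  by exists 1 => //; exact: subring1.
have [i si|a Va Wa] := IHs; first by apply: VW; rewrite inE si orbT.
have [Wja|Wja] := pselect (W j a); last first.
  by exists a => // i; rewrite inE => /predU1P[->|/Wa].
have /existsNP[b /not_implyP[Vb Wjb]] := VW j (mem_head j s).
have [N NP] := exprD_notin_seq b Wa.
exists (a ^+ N + b); first by apply: subringD => //; exact: subringX.
move=> i; rewrite inE => /predU1P[->|si]; last exact: NP.
have ringWj := (valW j).1.
by apply: subring_addl_notin => //; exact: subringX.
Qed.

End Avoidance.

Theorem theorem2p28 (K : fieldType) (n : nat) (V : set K) (V_ : 'I_n -> set K)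
    (x : K) (hV : is_valuation_ring V)
    (hV_ : forall i : 'I_n, is_valuation_ring (V_ i))
    (hx : ~ (adjoin V x `<=` \bigcup_i V_ i)) :
  exists2 v : K, V v & ~ (\bigcup_i V_ i) (v + x).
Proof.
have ringV := hV.1.
have VxP i : V `<=` V_ i -> ~ V_ i x.
  move=> VVi Vix; apply: hx => y Vxy; exists i => //; apply: Vxy.
  by split; [exact: (hV_ i).1|move=> z [/VVi|->]].
pose s := [seq i <- enum 'I_n | ~~ `[< V `<=` V_ i >]].
have sP i : reflect (~ V `<=` V_ i) (i \in s).
  by rewrite mem_filter mem_enum andbT; apply: (iffP idP) => /asboolPn.
have [a Va aP] := subring_avoid hV_ ringV (fun i => elimT (sP i)).
have [N NP] := exprD_notin_seq hV_ x aP.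
have VaN : V (a ^+ N) by exact: subringX.
exists (a ^+ N) => // -[i _].
have [VVi|/sP] := pselect (V `<=` V_ i); last exact: NP.
by apply: subring_addl_notin; [exact: (hV_ i).1|exact: VVi|exact: VxP].
Qed.
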